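(* There is a function $f:(0,\infty)\to\mathbb{N}$ with the following property. Let $G$ be a finite soluble group and let $\epsilon>0$ be a real number such that for any prime $p\in\pi(G)$ there is a Sylow $p$-subgroup $P$ and a Hall $p'$-subgroup $H$ of $G$ such that $\Pr(P,H)\ge\epsilon$. Then $|G:F(G)|\le f(\epsilon)$.
   Context: For subsets $X,Y$ of a finite group $G$, $\Pr(X,Y)=|\{(x,y)\in X\times Y: xy=yx\}|/(|X||Y|)$. $\pi(G)$ is the set of prime divisors of $|G|$; $F(G)$ is the Fitting subgroup of $G$. *)

(* Defs.v *)
From HB Require Import structures.
From mathcomp Require Import all_boot all_order all_algebra all_fingroup all_solvable.
From mathcomp Require Import reals.
Set Implicit Arguments. Unset Strict Implicit. Unset Printing Implicit Defensive.
Import GRing.Theory Num.Theory.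

Definition commPr (R : realType) (gT : finGroupType) (X Y : {set gT}) : R :=
  (#|[set xy in setX X Y | (xy.1 * xy.2 == xy.2 * xy.1)%g]|)%:R
    / (#|X| * #|Y|)%:R.

(* Main.v *)
Require Import Defs.
From HB Require Import structures.
From mathcomp Require Import all_boot all_order all_algebra all_fingroup all_solvable.
From mathcomp Require Import reals zify.
Import Order.TTheory GRing.Theory Num.Theory.
Local Open Scope group_scope.

(** Fix a prime p and an N with 1 / eps <= N. The commuting probability does not
    decrease on passing to subgroups or quotients, so dividing by 'O_p(G) we may
    assume 'O_p(G) = 1. Then F := 'F(G) is a p'-group containing its
    centraliser, and P acts faithfully and coprimely on the abelian group
    A := F / F'. A maximal normal abelian subgroup E of P is self-centralising,
    hence it is enough to bound #|E|. A positive proportion of the x in E have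
    an A-centraliser of bounded index; they generate a subgroup T in which
    every element is a product of boundedly many of them, so there is k with
    #|A : 'C_A[t]| <= k for all t in T. For t in T with 'C_A[t] of least order,
    A = [A, t] x 'C_A[t], and an element of T centralising [A, t] must
    centralise A by minimality; so T embeds in the permutations of [A, t], a
    set of at most k elements. Thus the p-part of #|G : 'F(G)| is at most
    some B depending only on N, for each p, and #|G : 'F(G)| divides B!. *)

Set Implicit Arguments.
Unset Strict Implicit.
Unset Printing Implicit Defensive.

(** * Coprime action and the Fitting subgroup *)

Section CoprimeAction.

Variable gT : finGroupType.
Implicit Types A F G L M P : {group gT}.

(** [A] acts trivially on [G / [~: G, A]], and by coprimality the fixed points of this quotient lift
    to fixed points in [G]. *)
Lemma coprime_commg_cent_prod A G :
    A \subset 'N(G) -> coprime #|G| #|A| -> solvable G ->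
  [~: G, A] * 'C_G(A) = G.
Proof.
move=> nGA coGA solG; have sRG: [~: G, A] \subset G by rewrite commg_subl.
apply/eqP; rewrite eqEsubset mulG_subG sRG subsetIl /=.
have nRG : G \subset 'N([~: G, A]) by rewrite commg_norml.
have nRA : A \subset 'N([~: G, A]) by rewrite commg_normr.
rewrite -quotientSK // coprime_quotient_cent // subsetI subxx.
by rewrite quotient_cents2r.
Qed.

(** A proper [L] would be subnormal, hence inside a proper normal [N]; then [F / N] would be
    perfect, against solubility. *)
Lemma nilpotent_der1_mulg F L :
  nilpotent F -> L \subset F -> F \subset F^`(1) * L -> L :=: F.
Proof.
move=> nilF sLF defF.
have [//|[N [/subnormal_sub sLN nsNF pNF]]] :=
  subnormalEr (nilpotent_subnormal nilF sLF).
have nNF := normal_norm nsNF.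
have ntFN : F / N != 1.
  by rewrite -subG1 quotient_sub1 // proper_subn.
have := sol_der1_proper (quotient_sol N (nilpotent_sol nilF)) (subxx _) ntFN.
rewrite properE => /andP[_ /negP[]].
rewrite /= -quotient_der // quotientSK //.
by rewrite -(normC (subset_trans (der_sub 1 F) nNF)) (subset_trans defF) ?mulgS.
Qed.

Lemma coprime_cent_der1 F P :
    nilpotent F -> P \subset 'N(F) -> coprime #|F| #|P| ->
  [~: F, P] \subset F^`(1) -> P \subset 'C(F).
Proof.
move=> nilF nFP coFP sRF'.
rewrite centsC; apply/setIidPl.
apply: (@nilpotent_der1_mulg F 'C_F(P)%G nilF (subsetIl _ _)).
by rewrite -{1}(coprime_commg_cent_prod nFP coFP (nilpotent_sol nilF)) mulSg.
Qed.

(** Otherwise some [K] normal in [G] lies in the centraliser but not in [Z], with [K / Z] abelian.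
    As [K] centralises [Z], it has class at most 2, so it lies in ['F(G)], a contradiction. *)
Lemma cent_sub_Fitting G : solvable G -> 'C_G('F(G)) \subset 'F(G).
Proof.
move=> solG; apply/idPn=> nsCF.
set Z := 'C_G('F(G)) :&: 'F(G).
have nsFG := Fitting_normal G.
have nsCG : 'C_G('F(G)) <| G by rewrite norm_normalI ?norms_cent ?normal_norm.
have nsZG : Z <| G by rewrite normalI.
have nZG := normal_norm nsZG.
have ntCZ : 'C_G('F(G)) / Z != 1.
  rewrite -subG1 quotient_sub1; last exact: subset_trans (normal_sub nsCG) nZG.
  by rewrite subsetI subxx.
have solC := solvableS (normal_sub nsCG) solG.
have [Kb [sKbC nsKbG ntKb abKb]] :=
  solvable_norm_abelem (quotient_sol Z solC) (quotient_normal Z nsCG) ntCZ.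
have [K defKb sZK nsKG] := inv_quotientN nsZG nsKbG.
rewrite defKb in sKbC ntKb abKb.
have nZK := subset_trans (normal_sub nsKG) nZG.
have sKC : K \subset 'C_G('F(G)).
  by rewrite -(quotientSGK nZK) // subsetIl.
have sK'Z : [~: K, K] \subset Z.
  rewrite -quotient_cents2 //.
  by have [q _ /abelem_abelian] := is_abelemP abKb.
have nilK : nilpotent K.
  apply/lcnP; exists 2; apply/commG1P.
  apply: subset_trans sK'Z _; rewrite centsC (subset_trans sKC) //.
  by rewrite subIset // centS ?orbT // subsetIr.
case/negP: ntKb; rewrite -subG1 quotient_sub1 // subsetI sKC.
exact: Fitting_max.
Qed.

Lemma index_cent_leq_fact G M : G \subset 'N(M) -> #|G : 'C_G(M)| <= #|M|`!.
Proof.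
move=> nMG; rewrite -card_perm -ker_conj_aut indexgI.
rewrite (_ : #|G : _| = #|conj_aut M @* G|); last by rewrite card_morphim (setIidPr nMG).
apply: leq_trans (subset_leq_card (Aut_conj_aut _ _)) _.
by apply/subset_leq_card/subsetP=> a; rewrite inE => /andP[].
Qed.

End CoprimeAction.

(** * Faithful coprime action of an abelian group *)

Lemma abelian_faithful_bound (gT : finGroupType) (T A : {group gT}) k :
    abelian T -> abelian A -> T \subset 'N(A) -> coprime #|A| #|T| ->
    'C_T(A) = 1 -> {in T, forall t, #|A| <= k * #|'C_A[t]|} ->
  #|T| <= k`!.
Proof.
move=> cTT cAA nAT coAT faT bdT.
have [t Tt mint] := @arg_minnP _ 1 [in T] (fun t => #|'C_A[t]|) (group1 T).
have sTt : <[t]> \subset T by rewrite cycle_subG.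
have nAt := subset_trans sTt nAT.
have coAt := coprimegS sTt coAT.
set M := [~: A, <[t]>].
have defA : M * 'C_A(<[t]>) = A.
  exact: coprime_commg_cent_prod (abelian_sol cAA).
have tiM : M :&: 'C_A(<[t]>) = 1.
  apply/trivgP; rewrite -(coprime_abel_cent_TI nAt coAt cAA).
  by rewrite setIS // subsetIr.
have sMA : M \subset A by rewrite commg_subl.
have cTt : T \subset 'C(<[t]>) by rewrite (subset_trans cTT) ?centS.
have nMT : T \subset 'N(M) by rewrite normsR // cents_norm.
have leMk : #|M| <= k.
  have := bdT t Tt; rewrite -cent_cycle -{1}defA TI_cardMg //.
  by rewrite leq_pmul2r.
apply: leq_trans (leq_fact leMk); apply: leq_trans (index_cent_leq_fact nMT).
suff -> : 'C_T(M) = 1 by rewrite indexg1.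
apply/trivgP; rewrite -faT; apply/subsetP=> u /setIP[Tu cMu].
(* On M the product u * t acts as t, without fixed points, and on 'C_A[t] it
   acts as u; so by minimality of 'C_A[t], u centralises 'C_A[t]. *)
have sCut : 'C_A[u * t] \subset 'C_A[t] :&: 'C[u].
  apply/subsetP=> a /setIP[Aa /cent1P cuta].
  have /mulsgP[m c Mm Cc defa] : a \in M * 'C_A(<[t]>) by rewrite defA.
  have [Ac ctc] := setIP Cc.
  have Ccu : c ^ u \in 'C_A(<[t]>).
    rewrite memJ_norm // (subsetP _ u Tu) // normsI //.
    exact: subset_trans cTt (norms_cent (cent_sub _)).
  have Mmt : m ^ t \in M by rewrite memJ_norm // (subsetP nMT).
  have e1 : m ^ t * c ^ u = m * c.
    have cm : m ^ u = m by apply/conjg_fixP/commgP/commute_sym/(centP cMu).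
    have cc : (c ^ u) ^ t = c ^ u.
      apply/conjg_fixP/commgP/commute_sym/cent1P.
      by move: Ccu; rewrite cent_cycle => /setIP[_]; rewrite cent1C.
    rewrite -defa -[RHS](_ : a ^ (u * t) = a); last first.
      by apply/conjg_fixP/commgP.
    by rewrite defa conjgM (conjMg m c u) cm conjMg cc.
  (* The left side lies in [M], the right side in ['C_A(<[t]>)], so both are trivial: [u] fixes [c],
     and [t] fixes [m], whence [m = 1]. *)
  have e2 : m^-1 * m ^ t = c * (c ^ u)^-1.
    by rewrite -[m ^ t](mulgK (c ^ u)) e1 -!mulgA mulKg.
  have : m^-1 * m ^ t \in M :&: 'C_A(<[t]>).
    apply/setIP; split; first by rewrite groupM ?groupV.
    by rewrite e2 groupM ?groupV.
  rewrite tiM => /set1P e3.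
  have ec : c ^ u = c.
    by apply/eqP; rewrite eq_sym eq_mulgV1 -e2 e3.
  have em : m = 1.
    suff : m \in M :&: 'C_A(<[t]>) by rewrite tiM => /set1P.
    rewrite inE Mm /= inE (subsetP sMA) //= cent_cycle cent1C.
    apply/cent1P/commute_sym/commgP/conjg_fixP.
    by apply/eqP; rewrite eq_sym eq_mulVg1 e3.
  rewrite defa em mul1g inE -cent_cycle Cc /= cent1C.
  by apply/cent1P/commute_sym/commgP/conjg_fixP.
have CuC : 'C_A[t] \subset 'C[u].
  have sCt : 'C_A[u * t] \subset 'C_A[t].
    by rewrite (subset_trans sCut) ?subsetIl.
  have /eqP <- : 'C_A[u * t] == 'C_A[t].
    by rewrite eqEcard sCt mint // groupM.
  by rewrite (subset_trans sCut) ?subsetIr.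
rewrite inE Tu /= -sub_cent1 -defA mulG_subG sub_cent1 cMu /=.
by rewrite cent_cycle.
Qed.

(** * Word length with respect to a large generating set *)

(** As [1 \in X], the powers of [X] increase; once one step adds nothing, no later step does, and
    some power is all of [<<X>>]. *)
Lemma gen_sub_expgs (gT : finGroupType) (X : {set gT}) n :
  1 \in X -> X ^+ n.+1 \subset X ^+ n -> <<X>> \subset X ^+ n.
Proof.
move=> X1 sXn; have [k ->] := gen_expgs X.
rewrite (setUidPr _) ?sub1set //.
have [|/ltnW/subnKC <-] := leqP k n.
  move/subnKC <-; elim: (n - k) => [|i IHi]; rewrite ?addn0 // addnS expgSr.
  by rewrite (subset_trans IHi) // mulg_subl.
elim: (k - n) => [|i IHi]; rewrite ?addn0 // addnS expgSr.
by rewrite (subset_trans _ sXn) // expgSr mulSg.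
Qed.

(* If y has word length exactly n + 2, then y *: X misses X ^+ n but lies in
   X ^+ (n + 3), so every three steps the ball grows by at least #|X|. *)
Lemma gen_small_diameter (gT : finGroupType) (G : {group gT}) (X : {set gT}) c :
    X \subset G -> 1 \in X -> X^-1%g = X -> #|G| <= c * #|X| ->
  <<X>> \subset X ^+ (3 * c).+1.
Proof.
move=> sXG X1 XV leG.
have sXn m n : m <= n -> X ^+ m \subset X ^+ n.
  move/subnKC <-; elim: (n - m) => [|i IHi]; rewrite ?addn0 // addnS expgSr.
  by rewrite (subset_trans IHi) // mulg_subl.
have sXnG n : X ^+ n \subset G.
  by elim: n => [|n IHn]; rewrite ?expg0 ?sub1G // expgS mul_subG.
(* At [n = c] the second alternative would give [c.+1 * #|X| <= #|G| <= c * #|X|]. *)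
suff /(_ c)[//|leX] : forall n, <<X>> \subset X ^+ (3 * n).+1
    \/ n.+1 * #|X| <= #|X ^+ (3 * n).+1|.
  have := leq_trans leX (subset_leq_card (sXnG _)).
  move/leq_trans/(_ leG); rewrite leq_pmul2r ?ltnn //.
  by apply/card_gt0P; exists 1.
elim=> [|n [IHn|IHn]].
- by right; rewrite muln0 expg1 mul1n.
- by left; rewrite (subset_trans IHn) // sXn; lia.
have [sX2|] := boolP (X ^+ (3 * n).+3 \subset X ^+ (3 * n).+2).
  left; rewrite (subset_trans (gen_sub_expgs X1 sX2)) // sXn; lia.
case/subsetPn=> y Xy nXy; right.
have dXy : [disjoint y *: X & X ^+ (3 * n).+1].
  apply/pred0P=> z /=; apply/negP=> /andP[/lcosetP[x Xx ->] Xyx].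
  case/negP: nXy; rewrite expgSr; apply/mulsgP.
  exists (y * x) x^-1; rewrite ?mulgK //.
  by rewrite -mem_invg XV.
rewrite mulSn -{1}(card_lcoset X y).
rewrite (leq_trans (leq_add (leqnn _) IHn)) // -cardsUI.
have /eqP -> : y *: X :&: X ^+ (3 * n).+1 == set0 by rewrite setI_eq0.
rewrite cards0 addn0 subset_leq_card // subUset sXn ?andbT; last by lia.
have -> : (3 * n.+1).+1 = (3 * n).+4 by lia.
rewrite expgSr; apply/subsetP=> _ /lcosetP[x Xx ->].
exact: mem_mulg.
Qed.

(** * Commuting probability in subgroups and quotients *)

Section CommutingPairs.

Variable gT : finGroupType.
Implicit Types X Y K : {group gT}.

Definition commuting_pairs (X Y : {set gT}) : {set gT * gT} :=
  [set xy in setX X Y | xy.1 * xy.2 == xy.2 * xy.1].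

(* The probability that x in X and y in Y commute is at least 1 / N. *)
Definition commPr_geV N (X Y : {set gT}) :=
  #|X| * #|Y| <= N * #|commuting_pairs X Y|.

Lemma card_commuting_pairs (X Y : {set gT}) :
  #|commuting_pairs X Y| = \sum_(x in X) #|'C_Y[x]|.
Proof.
rewrite -sum1_card (eq_bigl (fun z : gT * gT => (z.1 \in X) && (z.2 \in 'C_Y[z.1]))).
  rewrite -(pair_big_dep (fun x => x \in X) (fun x y => y \in 'C_Y[x]) (fun _ _ => 1%N)) /=.
  by apply: eq_bigr => x _; rewrite sum1_card.
move=> [x y]; rewrite inE in_setX in_setI -andbA cent1C /=; congr [&& _, _ & _].
exact/eqP/cent1P.
Qed.

Lemma card_commuting_pairsC (X Y : {set gT}) :
  #|commuting_pairs X Y| = #|commuting_pairs Y X|.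
Proof.
pose swap (z : gT * gT) := (z.2, z.1).
have swapK : involutive swap by case.
rewrite -(card_imset _ (inv_inj swapK)) (can_imset_pre _ swapK).
by apply/eq_card=> -[x y]; rewrite !inE /= eq_sym (andbC (y \in X)).
Qed.

Lemma commPr_geVC N (X Y : {set gT}) : commPr_geV N X Y -> commPr_geV N Y X.
Proof. by rewrite /commPr_geV card_commuting_pairsC mulnC. Qed.

(** For each [x] the product of [Y1] and ['C_Y[x]] lies in [Y], so the centraliser of [x] has index
    in [Y1] at most its index in [Y]. *)
Lemma commPr_geVSr N X (Y Y1 : {group gT}) :
  Y1 \subset Y -> commPr_geV N X Y -> commPr_geV N X Y1.
Proof.
rewrite /commPr_geV !card_commuting_pairs => sY1Y leN.
rewrite -(leq_pmul2l (cardG_gt0 Y)) mulnA (mulnC #|Y|).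
apply: leq_trans (leq_mul leN (leqnn #|Y1|)) _.
rewrite -mulnA [X in _ <= X]mulnCA leq_mul2l big_distrl big_distrr /=; apply/orP; right.
apply: leq_sum => x _; rewrite mul_cardG leq_mul ?subset_leq_card //.
  by rewrite mul_subG ?subsetIl.
by rewrite /= setIAC setSI // subsetIr.
Qed.

Lemma commPr_geVSl N (X X1 Y : {group gT}) :
  X1 \subset X -> commPr_geV N X Y -> commPr_geV N X1 Y.
Proof. by move=> sX1X /commPr_geVC/(commPr_geVSr sX1X)/commPr_geVC. Qed.

Lemma card_quotient_capl X K : X \subset 'N(K) -> (#|X :&: K| * #|X / K|)%N = #|X|.
Proof. by move=> nKX; rewrite card_quotient // LagrangeI. Qed.

End CommutingPairs.

(** ['C_Y[x]] maps into the centraliser of the coset of [x] with fibres of size at most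
    [#|Y :&: K|], and each coset contains at most [#|X :&: K|] elements of [X]. *)
Lemma card_commuting_pairs_quotient (gT : finGroupType) (X Y K : {group gT}) :
    X \subset 'N(K) -> Y \subset 'N(K) ->
  #|commuting_pairs X Y|
    <= #|X :&: K| * #|Y :&: K| * #|commuting_pairs (X / K) (Y / K)|.
Proof.
move=> nKX nKY; rewrite !card_commuting_pairs.
pose g xb := #|'C_(Y / K)[xb]|.
apply: (@leq_trans (\sum_(x in X) #|Y :&: K| * g (coset K x))).
  apply: leq_sum => x Xx.
  have nKC : 'C_Y[x] \subset 'N(K) by rewrite subIset ?nKY.
  rewrite -(card_quotient_capl nKC) leq_mul ?subset_leq_card //.
    by rewrite setSI ?subsetIl.
  exact: quotient_subcent1.
rewrite -big_distrr /= [X in _ <= X * _]mulnC -mulnA leq_mul2l; apply/orP; right.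
rewrite (partition_big_imset (coset K)) /= quotientE morphimEsub //.
rewrite big_distrr /=; apply: leq_sum => _ /imsetP[x0 Xx0 ->].
rewrite (eq_bigr (fun=> g (coset K x0))); last by move=> x /andP[_ /eqP ->].
rewrite sum_nat_const leq_mul2r; apply/orP; right.
rewrite -(card_rcoset _ x0) subset_leq_card //.
apply/subsetP=> x /andP[Xx /eqP eqx].
rewrite mem_rcoset inE groupM ?groupV //=.
have [nx nx0] := (subsetP nKX x Xx, subsetP nKX x0 Xx0).
by rewrite coset_idr ?groupM ?groupV // morphM ?morphV ?groupV //= eqx mulgV.
Qed.

Lemma commPr_geV_quotient (gT : finGroupType) N (X Y K : {group gT}) :
    X \subset 'N(K) -> Y \subset 'N(K) ->
  commPr_geV N X Y -> commPr_geV N (X / K) (Y / K).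
Proof.
move=> nKX nKY; rewrite /commPr_geV => leN.
have := leq_trans leN (leq_mul (leqnn N) (card_commuting_pairs_quotient nKX nKY)).
rewrite -{1}(card_quotient_capl nKX) -{1}(card_quotient_capl nKY) mulnACA.
by rewrite [X in _ <= X]mulnCA leq_pmul2l // muln_gt0 !cardG_gt0.
Qed.

(** * Bounds for abelian groups, then for p-groups *)

(** The elements with centraliser of index at most [c = 2 * N] make up at least [1 / c] of the
    group; words of length [(3 * c).+1] in them have centralisers of index at most
    [c ^ (3 * c).+1]. *)
Definition abelian_bound N := (2 * N * ((2 * N) ^ (3 * (2 * N)).+1)`!)%N.

Lemma abelian_commPr_bound (gT : finGroupType) N (E A : {group gT}) :
    abelian E -> abelian A -> E \subset 'N(A) -> coprime #|A| #|E| ->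
    'C_E(A) = 1 -> commPr_geV N E A ->
  #|E| <= abelian_bound N.
Proof.
move=> cEE cAA nAE coAE faE leN.
pose X := [set x in E | #|A| <= 2 * N * #|'C_A[x]|].
have sXE : X \subset E by apply/subsetP=> x; rewrite inE => /andP[].
have N_gt0 : 0 < N.
  by case: N leN {X sXE} => //; rewrite /commPr_geV mul0n leqn0 muln_eq0 !eqn0Ngt !cardG_gt0.
have leEX : #|E| <= 2 * N * #|X|.
  (* An element of [E] outside [X] commutes with fewer than [#|A| / (2 * N)] elements of [A], so
     such elements supply at most half of the required pairs. *)
  have leS : 2 * N * #|commuting_pairs E A| <= 2 * N * (#|X| * #|A|) + #|E| * #|A|.
    rewrite card_commuting_pairs (bigID [in X]) /= mulnDr leq_add //.
      rewrite leq_mul2l; apply/orP; right.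
      rewrite (eq_bigl [in X]) => [|x]; last first.
        by rewrite andb_idl // => /(subsetP sXE).
      rewrite -sum_nat_const; apply: leq_sum => x _.
      by rewrite subset_leq_card ?subsetIl.
    rewrite big_distrr -sum_nat_const /= big_mkcondr /=.
    apply: leq_sum => x Ex; case: ifP => //; rewrite inE Ex /= -ltnNge.
    exact: ltnW.
  rewrite -(leq_pmul2r (cardG_gt0 A)); move: leN leS; rewrite /commPr_geV.
  set c := #|commuting_pairs _ _|; rewrite -!mulnA; set d := (N * (_ * _))%N.
  set e := (#|E| * _)%N; set f := (N * c)%N; lia.
have X1 : 1 \in X by rewrite inE group1 cent11T setIT leq_pmull // muln_gt0.
have XV : X^-1%g = X.
  apply/setP=> x; rewrite !inE groupV; congr (_ && (_ <= _ * #|pred_of_set (_ :&: _)|)).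
  by rewrite -!cent_cycle cycleV.
have sTE : <<X>> \subset E by rewrite gen_subG.
(* Indices of centralisers are submultiplicative, as ['C_A[y * z]] contains ['C_A[y] :&:
   'C_A[z]]. *)
have bdX n x : x \in X ^+ n -> #|A| <= (2 * N) ^ n * #|'C_A[x]|.
  elim: n x => [|n IHn] x.
    by rewrite expg0 => /set1P->; rewrite cent11T setIT mul1n.
  rewrite expgS => /mulsgP[y z]; rewrite inE => /andP[Ey ley] /IHn lez ->.
  have sC : 'C_A[y] :&: 'C_A[z] \subset 'C_A[y * z].
    apply/subsetP=> a; rewrite !in_setI -andbA => /and4P[Aa cya _ cza].
    by rewrite Aa /= cent1C groupM // cent1C.
  have leI : #|'C_A[y]| * #|'C_A[z]| <= #|A| * #|'C_A[y * z]|.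
    by rewrite mul_cardG leq_mul ?subset_leq_card // mul_subG ?subsetIl.
  rewrite -(leq_pmul2l (cardG_gt0 A)) (leq_trans (leq_mul ley lez)) // mulnACA -expnS.
  by rewrite [X in _ <= X]mulnCA leq_mul2l leI orbT.
have bdT : {in <<X>>, forall t, #|A| <= (2 * N) ^ (3 * (2 * N)).+1 * #|'C_A[t]|}.
  by move=> t /(subsetP (gen_small_diameter sXE X1 XV leEX))/bdX.
have leT : #|<<X>>| <= ((2 * N) ^ (3 * (2 * N)).+1)`!.
  apply: abelian_faithful_bound bdT => //.
  - exact: abelianS cEE.
  - exact: subset_trans nAE.
  - exact: coprimegS coAE.
  - by apply/trivgP; rewrite -faE setSI.
rewrite (leq_trans leEX) // leq_mul2l (leq_trans _ leT) ?orbT //.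
by rewrite subset_leq_card ?subset_gen.
Qed.

Definition pgroup_bound N := (abelian_bound N * (abelian_bound N)`!)%N.

Lemma pgroup_commPr_bound (gT : finGroupType) (p N : nat) (P A : {group gT}) :
    p.-group P -> abelian A -> P \subset 'N(A) -> coprime #|A| #|P| ->
    'C_P(A) = 1 -> commPr_geV N P A ->
  #|P| <= pgroup_bound N.
Proof.
move=> pP cAA nAP coAP faP leN.
have [|E maxE _] := @maxgroup_exists _ [pred E : {group gT} | (E <| P) && abelian E] 1%G.
  by rewrite /= normal1 abelian1.
have [nsEP cEP] := SCN_P (max_SCN pP maxE).
have [/andP[_ cEE] _] := maxgroupP maxE.
have sEP := normal_sub nsEP.
have leE : #|E| <= abelian_bound N.
  apply: (@abelian_commPr_bound _ N E A) => //.
  - exact: subset_trans nAP.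
  - exact: coprimegS coAP.
  - by apply/trivgP; rewrite -faP setSI.
  - exact: commPr_geVSl leN.
(* [E] is its own centraliser in [P], so [P / E] acts faithfully on [E]. *)
rewrite -(Lagrange sEP) leq_mul // -{1}cEP.
exact: leq_trans (index_cent_leq_fact (normal_norm nsEP)) (leq_fact leE).
Qed.

(** * Sylow subgroups and the index of the Fitting subgroup *)

Lemma pcore1_Sylow_bound (gT : finGroupType) (p N : nat) (G P H : {group gT}) :
    solvable G -> 'O_p(G) = 1 -> p.-Sylow(G) P -> p^'.-Hall(G) H ->
    commPr_geV N P H ->
  #|P| <= pgroup_bound N.
Proof.
move=> solG Op1 sylP hallH leN.
set F := 'F(G).
have pP := pHall_pgroup sylP; have sPG := pHall_sub sylP.
have nilF : nilpotent F := Fitting_nil G.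
have p'F : p^'.-group F.
  have := nilpotent_pcoreC p nilF.
  by rewrite p_core_Fitting Op1 dprod1g /F => <-; apply: pcore_pgroup.
have coFP : coprime #|F| #|P| by rewrite coprime_sym (pnat_coprime pP).
have nFP : P \subset 'N(F) := subset_trans sPG (normal_norm (Fitting_normal G)).
have sFH : F \subset H.
  by rewrite (subset_trans _ (pcore_sub_Hall hallH)) // pcore_max ?Fitting_normal.
have cPF1 : 'C_P(F) = 1.
  apply/trivgP; rewrite -(coprime_TIg coFP) subsetI subsetIl andbT.
  exact: subset_trans (setSI _ sPG) (cent_sub_Fitting solG).
have nF'P : P \subset 'N(F^`(1)) := gFnorm_trans _ nFP.
have nF'F : F \subset 'N(F^`(1)) := der_norm 1 F.
have tiPF' : F^`(1) :&: P = 1.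
  by rewrite coprime_TIg // (coprimeSg (der_sub 1 F)).
rewrite (card_isog (quotient_isog nF'P tiPF')).
apply: (@pgroup_commPr_bound _ p N (P / F^`(1)) (F / F^`(1))).
- exact: quotient_pgroup.
- exact: der_abelian.
- exact: quotient_norms.
- exact: coprime_morph.
(* If [x] acts trivially on the abelianisation of [F], then [<[x]>] centralises [F] by coprimality,
   so [x = 1]. *)
- apply/trivgP/subsetP=> _ /setIP[/morphimP[x nx Px ->] cx].
  have sxP : <[x]> \subset P by rewrite cycle_subG.
  suff : x \in 'C_P(F) by rewrite cPF1 => /set1P->; rewrite morph1 group1.
  rewrite inE Px -cycle_subG; apply: coprime_cent_der1 => //.
  - exact: subset_trans nFP.
  - exact: coprimegS coFP.
  rewrite -quotient_cents2 ?(subset_trans sxP) // centsC.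
  by rewrite quotient_cycle // cycle_subG.
- apply: commPr_geV_quotient => //; exact: commPr_geVSr leN.
Qed.

(** Since ['O_p(G)] lies in ['F(G)], the p-part of the index divides the order of the Sylow subgroup
    [P / 'O_p(G)] of a group with trivial p-core. *)
Lemma index_pcore_Sylow_bound (gT : finGroupType) (p N : nat) (G P H : {group gT}) :
    solvable G -> p.-Sylow(G) P -> p^'.-Hall(G) H -> commPr_geV N P H ->
  #|G : 'F(G)|`_p <= pgroup_bound N.
Proof.
move=> solG sylP hallH leN.
have nOG : G \subset 'N('O_p(G)) := normal_norm (pcore_normal p G).
have nOP := subset_trans (pHall_sub sylP) nOG.
have nOH := subset_trans (pHall_sub hallH) nOG.
have leP : #|P / 'O_p(G)| <= pgroup_bound N.
  apply: (@pcore1_Sylow_bound _ p N (G / 'O_p(G)) _ (H / 'O_p(G))).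
  - exact: quotient_sol.
  - exact: trivg_pcore_quotient.
  - exact: quotient_pHall.
  - exact: quotient_pHall.
  - exact: commPr_geV_quotient.
apply: leq_trans leP.
have sylPO := quotient_pHall nOP sylP.
rewrite (card_Hall sylPO) card_quotient //.
apply: dvdn_leq; first exact: part_gt0.
apply: partn_dvd => //; apply: indexgS.
exact: Fitting_max (pcore_normal p G) (pgroup_nil (pcore_pgroup p G)).
Qed.

Theorem theorem1p2 (R : realType) :
  exists f : R -> nat,
    forall (gT : finGroupType) (G : {group gT}) (eps : R),
      solvable G -> (0 < eps)%R ->
      (forall p : nat, p \in \pi(G) ->
         exists P : {group gT}, exists H : {group gT},
           [/\ p.-Sylow(G) P, p^'.-Hall(G) H & (eps <= commPr R P H)%R]) ->
      (#|G : 'F(G)| <= f eps)%N.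
Proof.
(* The successor of the truncation exceeds [eps^-1]. The factorial is a common multiple of all
   p-parts of the index, each being at most [pgroup_bound N]. *)
exists (fun eps => (pgroup_bound (Num.truncn eps^-1).+1)`!).
move=> gT G eps solG eps_gt0 hyp; set N := _.+1.
apply: dvdn_leq; first exact: fact_gt0.
apply/dvdn_partP=> // p; rewrite mem_primes => /and3P[p_pr _ p_dv].
have [|P [H [sylP hallH lePr]]] := hyp p.
  by rewrite mem_primes p_pr cardG_gt0 (dvdn_trans p_dv) ?dvdn_indexg.
apply: dvdn_fact; rewrite part_gt0 /=.
apply: (index_pcore_Sylow_bound solG sylP hallH).
have ltN : (eps^-1 < N%:R)%R by apply: truncnS_gt.
have PH_gt0 : (0 < (#|P| * #|H|)%:R :> R)%R by rewrite ltr0n muln_gt0 !cardG_gt0.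
rewrite /commPr_geV -(ler_nat R) [X in (_ <= X)%R]natrM.
move: lePr; rewrite /commPr -/(commuting_pairs P H) ler_pdivlMr // => lePr.
(* After multiplying by [eps], it remains to see that [1 <= eps * N]. *)
rewrite -(ler_pM2l eps_gt0) (le_trans lePr) // mulrA ler_peMl //.
by rewrite -ler_pdivrMl // mulr1 ltW.
Qed.
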